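(* Let $0<\alpha<1$ and $f\in\Lambda_\alpha(\mathbb{R})$. At almost every point $x\in\mathbb{R}$ (with respect to Lebesgue measure) such that there exists a constant $\delta=\delta(x)>0$ with $$\limsup_{h\to0^+}\frac{\sigma\{t\in[h,1]:\Delta_\alpha(f)(x,t)>\delta\}}{\log h^{-1}}>0,$$ there exists a constant $c=c(x)>0$ such that $$\limsup_{h\to0^+}\frac{\sigma\{t\in[h,1]:\Delta_\alpha(f)(x,t)<-c\}}{\log h^{-1}}>0.$$
   Context: For $0<\alpha<1$, $\Lambda_\alpha(\mathbb{R})$ is the class of functions $f:\mathbb{R}\to\mathbb{R}$ for which there is a constant $C=C(f)>0$ with $|f(x)-f(y)|\le C|x-y|^\alpha$ for all $x,y\in\mathbb{R}$. The $\alpha$-divided difference is $\Delta_\alpha(f)(x,h)=\dfrac{f(x+h)-f(x)}{|h|^\alpha}$. The measure $\sigma$ on $(0,\infty)$ is $\sigma(E)=\int_E \frac{dh}{h}$; in particular $\sigma([h,1])=\log h^{-1}$ for $0<h<1$ (natural logarithm). *)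

(* Defs.v *)
From HB Require Import structures.
From mathcomp Require Import all_boot all_order all_algebra.
From mathcomp Require Import all_classical all_reals all_analysis.

Set Implicit Arguments.
Unset Strict Implicit.
Unset Printing Implicit Defensive.

Import Order.TTheory GRing.Theory Num.Theory.
Import numFieldNormedType.Exports.

Local Open Scope classical_set_scope.
Local Open Scope ring_scope.

Definition holder_class (R : realType) (alpha : R) : set (R -> R) :=
  [set f | exists2 C : R, 0 < C &
     forall x y : R, `|f x - f y| <= C * `|x - y| `^ alpha].

Definition divided_difference (R : realType) (alpha : R) (f : R -> R)
    (x h : R) : R :=
  (f (x + h) - f x) / `|h| `^ alpha.

(* Only meaningful for E included in `]0, +oo[. *)
Definition sigma (R : realType) (E : set R) : \bar R :=
  (\int[@lebesgue_measure R]_(h in E) (h^-1)%:E)%E.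

(* The upper density at scale 0 of E with respect to sigma. The junk values of
   the quotient for h >= 1 do not matter, as the upper limit is taken along
   the filter of right neighborhoods of 0. *)
Definition upper_log_density (R : realType) (E : set R) : \bar R :=
  limf_esup
    (fun h : R => (sigma (`[h, 1%R]%classic `&` E) / (ln (h^-1))%:E)%E)
    (0 : R)^'+.

(* Main.v *)
(** Discretise the scales as t = q^k with q close to 1. For each such q the
    averages of the divided differences D_k(x) := Delta_alpha(f)(x, q^k) over
    k < n tend to 0 for almost every x. Indeed the integral over an interval of
    D_j D_k decays geometrically in |j - k|: averaging over the translations by
    i q^k, i < M, with q^j much larger than M q^k, leaves D_j nearly unchanged,
    whereas the M translates of D_k telescope to a quantity of size M^alpha
    instead of M. So the second moment of the partial sums grows linearly, and
    a strong law follows. Hence a positive upper density of scales with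
    D_k > delta must be compensated by a positive upper density of scales with
    D_k < -c. Since Delta_alpha(f)(x, t) is uniformly continuous in log t, the
    densities of discrete scales and the sigma-densities are comparable. *)
Require Import Defs.
From HB Require Import structures.
From mathcomp Require Import all_boot all_order all_algebra.
From mathcomp Require Import all_classical all_reals all_analysis.
From mathcomp Require Import measurable_realfun.
From mathcomp Require Import zify.
From mathcomp Require Import ring lra.

Import Order.TTheory GRing.Theory Num.Theory.
Import numFieldNormedType.Exports.

Local Open Scope classical_set_scope.
Local Open Scope ring_scope.

Set Implicit Arguments.
Unset Strict Implicit.
Unset Printing Implicit Defensive.

(** * A strong law for bounded functions with decaying correlations *)

Section BoundedSequences.
Context d (T : measurableType d) (R : realType) (mu : {measure set T -> \bar R}).
Variables (D : set T) (mD : measurable D) (muD : (mu D < +oo)%E).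

Lemma bounded_by_integrable (g : T -> R) (B : R) : measurable_fun D g ->
  (forall x, D x -> `|g x| <= B) -> mu.-integrable D (EFin \o g).
Proof.
move=> mg gB; apply: measurable_bounded_integrable => //.
exists B; split; first exact: num_real.
by move=> M BM x /= Dx; rewrite (le_trans (gB _ Dx))// ltW.
Qed.

Lemma Rintegral_sum_ord (n : nat) (g : nat -> T -> R) :
  (forall k, mu.-integrable D (EFin \o g k)) ->
  \int[mu]_(x in D) (\sum_(k < n) g k x) = \sum_(k < n) \int[mu]_(x in D) g k x.
Proof.
move=> ig; rewrite /Rintegral (_ : (fun x => (\sum_(k < n) g k x)%:E) =
    fun x => (\sum_(k < n) (g k x)%:E)%E); last first.
  by apply/funext => x; rewrite sumEFin.
rewrite (@integral_sum _ _ _ mu D mD 'I_n (fun k x => (g k x)%:E))//; last first.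
  by move=> k; exact: ig.
by rewrite -sum_fine// => k _; apply: (integrable_fin_num mD (ig k)).
Qed.

Variables (Y : nat -> T -> R) (B : R).
Hypothesis mY : forall k, measurable_fun D (Y k).
Hypothesis YB : forall k x, D x -> `|Y k x| <= B.

Let S n x := \sum_(k < n) Y k x.

Let mS n : measurable_fun D (S n).
Proof. exact: (@measurable_sum _ _ _ D 'I_n _ (fun k : 'I_n => Y k)). Qed.

Let B_ge0 x : D x -> 0 <= B.
Proof. by move=> Dx; apply: le_trans (YB 0 Dx). Qed.

Let SB n x : D x -> `|S n x| <= n%:R * B.
Proof.
move=> Dx; rewrite (le_trans (ler_norm_sum _ _ _))//.
rewrite (le_trans (ler_sum _ (fun (k : 'I_n) _ => YB k Dx)))//.
by rewrite sumr_const card_ord mulr_natl.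
Qed.

Let iYY j k : mu.-integrable D (EFin \o (fun x => Y j x * Y k x)).
Proof.
apply: (@bounded_by_integrable _ (B * B)); first exact: measurable_funM.
by move=> x Dx; rewrite normrM ler_pM// YB.
Qed.

Let iSY n k : mu.-integrable D (EFin \o (fun x => S n x * Y k x)).
Proof.
apply: (@bounded_by_integrable _ (n%:R * B * B)); first exact: measurable_funM.
by move=> x Dx; rewrite normrM ler_pM// ?SB ?YB.
Qed.

Let iSS n : mu.-integrable D (EFin \o (fun x => S n x ^+ 2)).
Proof.
apply: (@bounded_by_integrable _ ((n%:R * B) * (n%:R * B))).
  exact: measurable_funX.
by move=> x Dx; rewrite expr2 normrM ler_pM// SB.
Qed.

(** Induction on [n]: expanding the square, the new term [Y n] contributes a cross term with all its
    predecessors and a diagonal term. Correlations decay in [n - j], so the cross integral is at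
    most a geometric series, [K / (1 - rho)]. It counts twice, and the diagonal adds at most once
    more, whence the factor 3. *)
Lemma second_moment_sum_le (n : nat) (K rho : R) :
  0 <= K -> 0 <= rho -> rho < 1 ->
  (forall j d, \int[mu]_(x in D) (Y j x * Y (j + d)%N x) <= K * rho ^+ d) ->
  \int[mu]_(x in D) (\sum_(k < n) Y k x) ^+ 2 <= n%:R * (3 * K / (1 - rho)).
Proof.
move=> K0 rho0 rho1 YY; have r1 : 0 < 1 - rho by lra.
elim: n => [|n IH].
  under eq_Rintegral do rewrite big_ord0 expr0n/=.
  by rewrite Rintegral_cst// !mul0r.
under eq_Rintegral do rewrite big_ord_recr/=.
have -> : (fun x => (\sum_(i < n) Y i x + Y n x) ^+ 2) =
    (fun x => (S n x ^+ 2 + 2 * (S n x * Y n x)) + Y n x * Y n x).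
  by apply/funext => x; rewrite /S; ring.
have i2 : mu.-integrable D (EFin \o (fun x => 2 * (S n x * Y n x))).
  by apply: (@integrableZl _ _ _ mu D mD 2 (fun x => (S n x * Y n x)%:E)); exact: iSY.
have i3 : mu.-integrable D (EFin \o (fun x => S n x ^+ 2 + 2 * (S n x * Y n x))).
  exact: (integrableD mD (iSS n) i2).
rewrite (RintegralD mD i3 (iYY n n)) (RintegralD mD (iSS n) i2).
rewrite (RintegralZl _ mD (iSY n n)).
have YYn := YY n 0; rewrite addn0 expr0 mulr1 in YYn.
have SY : \int[mu]_(x in D) (S n x * Y n x) <= K / (1 - rho).
  have -> : \int[mu]_(x in D) (S n x * Y n x) =
      \sum_(j < n) \int[mu]_(x in D) (Y j x * Y n x).
    rewrite -(@Rintegral_sum_ord n (fun j x => Y j x * Y n x)) ?/S//.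
    by under eq_Rintegral do rewrite mulr_suml.
  apply: (@le_trans _ _ (\sum_(j < n) K * rho ^+ (n - j))).
    by apply: ler_sum => j _; rewrite (le_trans _ (YY j (n - j)%N))// subnKC// ltnW.
  rewrite -mulr_sumr ler_wpM2l//.
  rewrite -(@ler_pM2l _ (1 - rho))// divff ?gt_eqF//.
  suff -> : (1 - rho) * \sum_(j < n) rho ^+ (n - j) = rho - rho ^+ n.+1.
    by rewrite lerBlDr (le_trans (ltW rho1))// lerDl exprn_ge0.
  elim: (n) => [|m IHm]; first by rewrite big_ord0 mulr0 expr1 subrr.
  rewrite big_ord_recl/= subn0 mulrDr.
  under eq_bigr do rewrite /bump/= add1n subSS.
  by rewrite IHm !exprS; ring.
have KK : K <= K / (1 - rho) by rewrite ler_pdivlMr// ler_piMr//; lra.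
have -> : n.+1%:R * (3 * K / (1 - rho)) =
    n%:R * (3 * K / (1 - rho)) + 2 * (K / (1 - rho)) + K / (1 - rho).
  by rewrite -(natr1 n); ring.
by rewrite !lerD ?ler_wpM2l// (le_trans YYn).
Qed.

(* Along squares the second moments of the averages are summable; between
   consecutive squares the sums vary by at most [(2 m + 1) B]. *)
Lemma strong_law_of_decaying_correlations (K rho : R) :
  0 <= K -> 0 <= rho -> rho < 1 ->
  (forall j d, \int[mu]_(x in D) (Y j x * Y (j + d)%N x) <= K * rho ^+ d) ->
  {ae mu, forall x, D x -> forall e, 0 < e ->
    exists N, forall n, (N <= n)%N -> `|\sum_(k < n) Y k x| <= e * n%:R}.
Proof.
move=> K0 rho0 rho1 YY; set V := 3 * K / (1 - rho).
have V0 : 0 <= V by rewrite divr_ge0 ?mulr_ge0//; lra.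
pose g m x := (S (m.+1 ^ 2) x / (m.+1 ^ 2)%:R) ^+ 2.
have g0 m x : 0 <= g m x by exact: sqr_ge0.
have gE m x : g m x = ((m.+1 ^ 2)%:R ^- 2) * S (m.+1 ^ 2) x ^+ 2.
  by rewrite /g exprMn exprVn mulrC.
have ig m : mu.-integrable D (EFin \o g m).
  have -> : EFin \o g m = (fun x => ((m.+1 ^ 2)%:R ^- 2)%:E * (S (m.+1 ^ 2) x ^+ 2)%:E)%E.
    by apply/funext => x /=; rewrite gE.
  by apply: integrableZl => //; exact: iSS.
have mg m : measurable_fun D (EFin \o g m) := measurable_int _ (ig m).
have gle m : (\int[mu]_(x in D) (g m x)%:E <= (V * m.+1%:R ^- 2)%:E)%E.
  rewrite -[leLHS]fineK; last exact: integrable_fin_num (ig m).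
  rewrite lee_fin -/(Rintegral mu D (g m)).
  rewrite (_ : g m = fun x => (m.+1 ^ 2)%:R ^- 2 * S (m.+1 ^ 2) x ^+ 2); last first.
    by apply/funext => x; exact: gE.
  rewrite RintegralZl// (le_trans (ler_wpM2l _ (second_moment_sum_le _ K0 rho0 rho1 YY)))//.
  rewrite -/V natrX le_eqVlt; apply/orP; left; apply/eqP.
  have m0 : m.+1%:R != 0 :> R by [].
  by field.
have sum_sq n : \sum_(m < n) V * m.+1%:R ^- 2 <= V * 2.
  rewrite -mulr_sumr ler_wpM2l//.
  (* Strengthened so that induction goes through: [1 / (m + 2)^2] is at most
     [1 / (m + 1) - 1 / (m + 2)]. *)
  suff : \sum_(m < n.+1) (m.+1%:R ^- 2 : R) <= 2 - n.+1%:R^-1.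
    rewrite big_ord_recr/= => h; rewrite (le_trans _ (_ : 2 - n.+1%:R^-1 <= 2))//.
      by rewrite (le_trans _ h)// lerDl invr_ge0 exprn_ge0.
    by rewrite gerBl invr_ge0.
  elim: (n) => [|m IHm].
    by rewrite big_ord_recr big_ord0/= add0r expr1n invr1; lra.
  rewrite big_ord_recr/= (le_trans (lerD IHm (lexx _)))//.
  rewrite -addrA lerD2l -lerBrDl opprK -subr_ge0.
  have -> : - m.+2%:R^-1 + m.+1%:R^-1 - m.+2%:R ^- 2 =
     (m.+1%:R)^-1 * (m.+2%:R ^- 2) :> R.
    rewrite -(natr1 m.+1).
    have m0 : m.+1%:R != 0 :> R by [].
    have m1 : m.+1%:R + 1 != 0 :> R by rewrite natr1.
    by move: (m.+1%:R : R) m0 m1 => a a0 a1; field; rewrite a0 a1.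
  by rewrite mulr_ge0 ?invr_ge0// exprn_ge0.
(* By monotone convergence the series of the [g m] has finite integral. It is thus finite almost
   everywhere, which forces [g m x] to tend to 0 there. *)
have fin : (\int[mu]_(x in D) (\sum_(m <oo) (g m x)%:E) < +oo)%E.
  rewrite integral_nneseries//; last by move=> n x Dx; rewrite lee_fin.
  apply: (@le_lt_trans _ _ (V * 2)%:E); last exact: ltry.
  apply: lime_le.
    by apply: is_cvg_nneseries => n _ _; apply: integral_ge0 => x Dx; rewrite lee_fin.
  apply: nearW => n; rewrite big_mkord (le_trans (lee_sum _ (fun (m : 'I_n) _ => gle m)))//.
  by rewrite sumEFin lee_fin sum_sq.
have isum : mu.-integrable D (fun x => \sum_(m <oo) (g m x)%:E)%E.
  apply/integrableP; split.
    refine (ge0_emeasurable_sum _ _) => [k x Dx _|k _]; last exact: mg.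
    by rewrite lee_fin.
  apply: le_lt_trans fin; rewrite le_eqVlt; apply/orP; left; apply/eqP.
  apply: eq_integral => x _; apply: gee0_abs.
  by apply: nneseries_ge0 => n _ _; rewrite lee_fin.
have := integrable_ae mD isum; apply: filterS => x + Dx => /(_ Dx) gx e e0.
have cg : series (g ^~ x) @ \oo --> (limn (series (g ^~ x)) : R).
  apply: nnseries_is_cvg => //.
  by rewrite ge0_fin_numE// in gx; apply: nneseries_ge0 => n _ _; rewrite lee_fin.
(* [g] is a squared average, so [e ^+ 2 / 16] bounds the averages along squares by [e / 4]. *)
have /cvgrPdist_le/(_ (e ^+ 2 / 16)) : g ^~ x @ \oo --> 0.
  by apply: cvg_series_cvg_0; apply/cvg_ex; eexists; exact: cg.
case; first by rewrite divr_gt0// exprn_gt0.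
move=> N0 _ N0P.
have Bx := B_ge0 Dx.
(* From [N1] on, the at most [2 (m + 1)] terms beyond the last square, each bounded by [B], total at
   most [e / 4 * (m + 1)^2]. *)
pose N1 := (Num.truncn (8 * B / e)).+1.
have N1P : 8 * B / e < N1%:R by rewrite truncnS_gt.
exists ((maxn N0 N1).+1 ^ 2)%N => n nN.
(* [m + 1] is the integer square root of [n]. *)
have [m [mn nm]] : exists m, (m.+1 ^ 2 <= n /\ n <= m.+1 ^ 2 + 2 * m.+1)%N.
  have ex : exists m, (m.+1 ^ 2 <= n)%N by exists (maxn N0 N1).
  have bd m : (m.+1 ^ 2 <= n)%N -> (m <= n)%N.
    by apply: leq_trans; rewrite !expnS !expn0; nia.
  case: (ex_maxnP ex bd) => m mn mmax; exists m; split => //.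
  rewrite leqNgt; apply/negP => h; suff /mmax : (m.+2 ^ 2 <= n)%N by rewrite ltnn.
  rewrite (leq_trans _ h)//.
  by rewrite !expnS !expn0; nia.
have mN : (maxn N0 N1 <= m)%N.
  have : ((maxn N0 N1).+1 ^ 2 < m.+2 ^ 2)%N.
    by rewrite (leq_ltn_trans nN)// (leq_ltn_trans nm)// !expnS !expn0; nia.
  by rewrite ltn_exp2r.
have {N0P} := N0P m (leq_trans (leq_maxl _ _) mN).
rewrite sub0r normrN ger0_norm// /g => h.
have Sm : `|S (m.+1 ^ 2) x| <= e / 4 * (m.+1 ^ 2)%:R.
  have -> : e / 4 * (m.+1 ^ 2)%:R = `|e / 4 * (m.+1 ^ 2)%:R|.
    by rewrite ger0_norm// mulr_ge0// divr_ge0// ltW.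
  rewrite -ler_sqr ?nnegrE// !real_normK ?num_real// exprMn.
  rewrite -ler_pdivrMr ?exprn_gt0 ?ltr0n ?expn_gt0//.
  rewrite exprMn exprVn in h; rewrite (le_trans h)//.
  by rewrite le_eqVlt; apply/orP; left; apply/eqP; field.
have -> : \sum_(k < n) Y k x = S (m.+1 ^ 2) x + \sum_(m.+1 ^ 2 <= k < n) Y k x.
  by rewrite /S -!(big_mkord xpredT (fun k => Y k x)) -big_cat_nat.
rewrite (le_trans (ler_normD _ _))//.
have S2 : `|\sum_(m.+1 ^ 2 <= k < n) Y k x| <= (2 * m.+1)%:R * B.
  rewrite (le_trans (ler_norm_sum _ _ _))//.
  rewrite (le_trans (ler_sum _ (fun (k : nat) _ => YB k Dx)))//.
  by rewrite sumr_const_nat -[leLHS]mulr_natl ler_wpM2r// ler_nat leq_subLR.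
have Bm : 8 * B <= e * m.+1%:R.
  rewrite [leRHS]mulrC -ler_pdivrMr// (le_trans (ltW N1P))// ler_nat.
  by rewrite (leq_trans (leq_maxr N0 N1))// leqW.
have mR : (m.+1 ^ 2)%:R <= n%:R :> R by rewrite ler_nat.
have m2 : (2 * m.+1)%:R * B <= e / 4 * (m.+1 ^ 2)%:R.
  rewrite natrM natrX expr2.
  have m0 : 0 <= m.+1%:R :> R by [].
  by nra.
rewrite (le_trans (lerD Sm (le_trans S2 m2)))//.
have e4 : 0 <= e / 4 by lra.
have := ler_wpM2l e4 mR; have n0 : 0 <= n%:R :> R by [].
by nra.
Qed.

End BoundedSequences.

(** * Correlations of divided differences *)

Section IntervalIntegrals.
Context (R : realType).
Notation mu := (@lebesgue_measure R).

Lemma lebesgue_measure_itv_lty (a b : R) (b0 b1 : bool) :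
  (mu [set` Interval (BSide b0 a) (BSide b1 b)] < +oo)%E.
Proof. by rewrite lebesgue_measure_itv/=; case: ifP => // _; rewrite -EFinD ltry. Qed.

Lemma fine_lebesgue_measure_itv (a b : R) (b0 b1 : bool) : a <= b ->
  fine (mu [set` Interval (BSide b0 a) (BSide b1 b)]) = b - a.
Proof.
rewrite lebesgue_measure_itv/= lte_fin le_eqVlt => /predU1P[<-|->] //.
by rewrite ltxx subrr.
Qed.

Lemma continuous_integrable_itv (F : R -> R) (a b : R) (b0 b1 : bool) :
  continuous F ->
  mu.-integrable [set` Interval (BSide b0 a) (BSide b1 b)] (EFin \o F).
Proof.
move=> cF; have iF : mu.-integrable `[a, b] (EFin \o F).
  apply: continuous_compact_integrable; first exact: segment_compact.
  exact: continuous_subspaceT.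
apply: integrableS iF => //; apply: subset_itv.
  by case: b0; rewrite bnd_simp.
by case: b1; rewrite bnd_simp.
Qed.

Lemma normr_Rintegral_itv_le (F : R -> R) (B a b : R) (b0 b1 : bool) :
  a <= b -> continuous F -> (forall x, `|F x| <= B) ->
  `|\int[mu]_(x in [set` Interval (BSide b0 a) (BSide b1 b)]) F x| <= B * (b - a).
Proof.
move=> ab cF FB.
have iF := continuous_integrable_itv a b b0 b1 cF.
rewrite (le_trans (le_normr_Rintegral _ iF))//.
rewrite -(fine_lebesgue_measure_itv b0 b1 ab) -Rintegral_cst//.
apply: le_Rintegral => //.
- by apply: continuous_integrable_itv => x; apply: cvg_norm; exact: cF.
- by apply: continuous_integrable_itv => x; exact: cvg_cst.
Qed.

Lemma continuous_translate (F : R -> R) (y : R) :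
  continuous F -> continuous (fun x => F (x + y)).
Proof.
move=> cF x; apply: (@continuous_comp _ _ _ (fun x : R => x + y) F).
  by apply: cvgD; [exact: cvg_id|exact: cvg_cst].
exact: cF.
Qed.

Lemma Rintegral_translate (F : R -> R) (a b y : R) : a <= b -> continuous F ->
  \int[mu]_(x in `[a, b]) F (x + y) = \int[mu]_(x in `[a + y, b + y]) F x.
Proof.
move=> ab cF.
have d1 : (fun x : R => x + y)^`()%classic = cst 1.
  apply/funext => x; rewrite derive1E.
  exact: (@derive_val _ _ _ _ _ _ _ (is_derive_shift x (1 : R) y)).
have cS : continuous (fun x : R => x + y).
  by move=> x; apply: cvgD; [exact: cvg_id|exact: cvg_cst].
have := @integration_by_substitution_increasing R (fun x => x + y) F a b ab.
rewrite d1 /Rintegral => ->.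
- by congr fine; apply: eq_integral => x _ /=; rewrite mulr1.
- by move=> u v _ _ uv; rewrite ltrD2r.
- by move=> x _; exact: cvg_cst.
- by apply/cvg_ex; exists 1; exact: cvg_cst.
- by apply/cvg_ex; exists 1; exact: cvg_cst.
- split => [x _ | |].
  + exact: (@ex_derive _ _ _ _ _ _ _ (is_derive_shift x (1 : R) y)).
  + by apply: cvg_at_right_filter; exact: cS.
  + by apply: cvg_at_left_filter; exact: cS.
- exact: continuous_subspaceT.
Qed.

Lemma Rintegral_itv_cat (F : R -> R) (a b c : R) : a <= b -> b <= c ->
  continuous F -> \int[mu]_(x in `[a, c]) F x =
  \int[mu]_(x in `[a, b]) F x + \int[mu]_(x in `[b, c]) F x.
Proof.
move=> ab bc cF.
rewrite -(@Rintegral_itv_obnd_cbnd R b (BRight c)); last exact: continuous_integrable_itv.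
rewrite -(@Rintegral_itvB R F (BLeft a) (BRight c) b).
- by rewrite addrC subrK.
- exact: continuous_integrable_itv.
- by rewrite bnd_simp.
- by rewrite bnd_simp.
Qed.

(** Both [[a, b]] and its translate become [[a, b + y]] once an interval of length [y] is added.
    This also covers shifts longer than [b - a]. *)
Lemma Rintegral_translate_dist (F : R -> R) (B a b y : R) :
  a <= b -> 0 <= y -> continuous F -> (forall x, `|F x| <= B) ->
  `|\int[mu]_(x in `[a, b]) F x - \int[mu]_(x in `[a, b]) F (x + y)| <= 2 * B * y.
Proof.
move=> ab y0 cF FB; rewrite Rintegral_translate//.
have e1 := @Rintegral_itv_cat F a b (b + y) ab ltac:(lra) cF.
have e2 := @Rintegral_itv_cat F a (a + y) (b + y) ltac:(lra) ltac:(lra) cF.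
have := @normr_Rintegral_itv_le F B a (a + y) true false ltac:(lra) cF FB.
have := @normr_Rintegral_itv_le F B b (b + y) true false ltac:(lra) cF FB.
rewrite !ler_norml; rewrite e1 in e2; lra.
Qed.

End IntervalIntegrals.

(** * Size, regularity, cancellation and correlation of divided differences *)

Section DividedDifference.
Context (R : realType) (alpha : R) (f : R -> R) (C : R).
Notation mu := (@lebesgue_measure R).
Notation D := (divided_difference alpha f).
Hypothesis fH : forall x y, `|f x - f y| <= C * `|x - y| `^ alpha.

Lemma powRV (x a : R) : 0 <= x -> x^-1 `^ a = (x `^ a)^-1.
Proof. by move=> x0; rewrite -powR_inv1// -powRrM mulN1r powRN. Qed.

Lemma powR_div (x y a : R) : 0 <= x -> 0 <= y -> (x / y) `^ a = x `^ a / y `^ a.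
Proof. by move=> x0 y0; rewrite powRM ?invr_ge0// powRV. Qed.

Lemma divided_difference_bound (x h : R) : 0 < h -> `|D x h| <= C.
Proof.
move=> h0; rewrite /divided_difference normrM normfV (ger0_norm (powR_ge0 _ _)).
rewrite ler_pdivrMr ?powR_gt0 ?normr_gt0 ?gt_eqF//.
by rewrite (le_trans (fH _ _))// addrC addKr.
Qed.

Lemma divided_difference_translate (x y h : R) : 0 < h ->
  `|D x h - D y h| <= 2 * C * (`|x - y| / h) `^ alpha.
Proof.
move=> h0; rewrite powR_div ?normr_ge0 ?(ltW h0)// /divided_difference (gtr0_norm h0) -mulrBl.
rewrite normrM normfV (ger0_norm (powR_ge0 _ _)) mulrA ler_wpM2r ?invr_ge0 ?powR_ge0//.
have -> : f (x + h) - f x - (f (y + h) - f y) =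
  (f (x + h) - f (y + h)) - (f x - f y) by lra.
rewrite (le_trans (ler_normB _ _))// -mulrA mulrDl mul1r lerD//.
by have -> : x - y = x + h - (y + h) by ring.
Qed.

(** The steps of length [s] tile [[x, x + M s]], so only the increment of [f] over the whole
    interval survives. This is the source of cancellation: the trivial bound would be [C * M]. *)
Lemma divided_difference_telescope (x s : R) (M : nat) : 0 < s ->
  `|\sum_(i < M) D (x + i%:R * s) s| <= C * M%:R `^ alpha.
Proof.
move=> s0; have -> : \sum_(i < M) D (x + i%:R * s) s = (f (x + M%:R * s) - f x) / s `^ alpha.
  rewrite /divided_difference -mulr_suml gtr0_norm//; congr (_ / _).
  rewrite -(big_mkord xpredT (fun i => f (x + i%:R * s + s) - f (x + i%:R * s))).
  rewrite (telescope_sumr_eq (fun i => f (x + i%:R * s)))//; first by rewrite mul0r addr0.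
  by move=> i _; rewrite -(natr1 i) mulrDl mul1r addrA.
rewrite normrM normfV (ger0_norm (powR_ge0 _ _)) ler_pdivrMr ?powR_gt0//.
rewrite (le_trans (fH _ _))// addrC addKr ger0_norm ?mulr_ge0 ?(ltW s0)//.
by rewrite powRM ?(ltW s0)// mulrA.
Qed.

Hypothesis alpha0 : 0 < alpha.

Lemma holder_continuous : continuous f.
Proof.
move=> x; apply/cvgrPdist_le => e e0.
have C0 : 0 <= C.
  by have := le_trans (normr_ge0 _) (fH 1 0); rewrite subr0 normr1 powR1 mulr1.
have C1 : 0 < C + 1 by rewrite ltr_wpDl.
(* Solves [(C + 1) * r^alpha = e]; the added 1 covers [C = 0]. *)
pose r := (e / (C + 1)) `^ alpha^-1.
have r0 : 0 < r by rewrite powR_gt0 ?divr_gt0.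
near=> y; rewrite (le_trans (fH _ _))//.
have xy : `|x - y| <= r by near: y; exact: cvgr_dist_le.
have : `|x - y| `^ alpha <= e / (C + 1).
  have <- : r `^ alpha = e / (C + 1).
    by rewrite /r -powRrM mulVf ?gt_eqF// powRr1// divr_ge0 ?ltW.
  by apply: ge0_ler_powR; rewrite ?nnegrE// ltW.
rewrite ler_pdivlMr// => h; rewrite (le_trans _ h)// mulrC ler_wpM2l ?powR_ge0//.
by rewrite lerDl.
Unshelve. all: by end_near. Qed.

Lemma divided_difference_continuous (h : R) : continuous (fun x => D x h).
Proof.
move=> x; apply: cvgM; last exact: cvg_cst.
apply: cvgB; last exact: holder_continuous.
by apply: continuous_translate; exact: holder_continuous.
Qed.

(* Average the integral over the translations by [i s], [i < M]. The factor
   of step [t] hardly notices them, and the factors of step [s] telescope. *)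
Lemma divided_difference_correlation (s t a b : R) (M : nat) :
  0 < s -> 0 < t -> a <= b -> (0 < M)%N ->
  `|\int[mu]_(x in `[a, b]) (D x t * D x s)| <=
  C ^+ 2 * (2 * (M%:R * s) + 2 * (b - a) * (M%:R * s / t) `^ alpha
            + (b - a) * (M%:R `^ alpha / M%:R)).
Proof.
move=> s0 t0 ab M0.
have cD := divided_difference_continuous.
have C0 : 0 <= C by exact: le_trans (normr_ge0 _) (divided_difference_bound 0 s0).
pose F x := D x t * D x s.
have cF : continuous F by move=> x; apply: cvgM; exact: cD.
have FB x : `|F x| <= C ^+ 2.
  by rewrite /F normrM expr2 ler_pM ?divided_difference_bound.
(* Only the factor of step [s] is translated. Below, [t1] is the cost of translating the whole
   product, [t2] that of moving the factor of step [t] back, and [t3] uses the telescoping. *)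
pose G i x := D x t * D (x + i%:R * s) s.
have cFi (i : nat) : continuous (fun x => F (x + i%:R * s)).
  exact: continuous_translate.
have cG i : continuous (G i).
  move=> x; apply: cvgM; first exact: cD.
  by apply: (@continuous_translate R (fun x => D x s)); exact: cD.
have MR : 0 < M%:R :> R by rewrite ltr0n.
have t1 (i : 'I_M) : `|\int[mu]_(x in `[a, b]) F x -
    \int[mu]_(x in `[a, b]) F (x + i%:R * s)| <= C ^+ 2 * (2 * (M%:R * s)).
  rewrite (le_trans (Rintegral_translate_dist ab _ cF FB))//.
    by rewrite mulr_ge0// ltW.
  have -> : 2 * C ^+ 2 * (i%:R * s) = C ^+ 2 * (2 * (i%:R * s)) by ring.
  have iM : (i%:R : R) <= M%:R by rewrite ler_nat ltnW.
  apply: ler_wpM2l; first exact: exprn_ge0.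
  by apply: ler_wpM2l => //; apply: ler_wpM2r => //; exact: ltW.
have t2 (i : 'I_M) : `|\int[mu]_(x in `[a, b]) F (x + i%:R * s) -
    \int[mu]_(x in `[a, b]) G i x| <=
    C ^+ 2 * (2 * (b - a) * (M%:R * s / t) `^ alpha).
  rewrite -RintegralB//; [|exact: continuous_integrable_itv..].
  have -> : C ^+ 2 * (2 * (b - a) * (M%:R * s / t) `^ alpha) =
    (2 * C * (M%:R * s / t) `^ alpha * C) * (b - a) by ring.
  apply: normr_Rintegral_itv_le => // [x|x].
    by apply: cvgB; [exact: cFi|exact: cG].
  rewrite /F /G -mulrBl normrM ler_pM ?divided_difference_bound//.
  rewrite (le_trans (divided_difference_translate _ _ _))//.
  rewrite addrC addKr ler_wpM2l ?mulr_ge0//.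
  have iM : (i%:R : R) <= M%:R by rewrite ler_nat ltnW.
  have t0' : 0 <= t^-1 by rewrite invr_ge0 ltW.
  rewrite ger0_norm ?(mulr_ge0 _ (ltW s0))//.
  apply: ge0_ler_powR; rewrite ?(ltW alpha0)// ?nnegrE ?mulr_ge0 ?(ltW s0)//.
  by apply: ler_wpM2r => //; apply: ler_wpM2r => //; exact: ltW.
have t3 : `|\sum_(i < M) \int[mu]_(x in `[a, b]) G i x| <=
    C ^+ 2 * ((b - a) * M%:R `^ alpha).
  rewrite -Rintegral_sum_ord//; last by move=> k; exact: continuous_integrable_itv.
  rewrite mulrCA mulrC; apply: normr_Rintegral_itv_le => // [x|x].
    apply: cvg_big => [|i _]; [exact: add_continuous|exact: cG].
  rewrite /G -mulr_sumr normrM expr2 -mulrA ler_pM ?divided_difference_bound//.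
  exact: divided_difference_telescope.
rewrite -(@ler_pM2l _ M%:R)//.
rewrite -{1}(ger0_norm (ltW MR)) -normrM.
have -> : M%:R * \int[mu]_(x in `[a, b]) F x =
    \sum_(i < M) (\int[mu]_(x in `[a, b]) F x - \int[mu]_(x in `[a, b]) F (x + i%:R * s))
  + \sum_(i < M) (\int[mu]_(x in `[a, b]) F (x + i%:R * s) - \int[mu]_(x in `[a, b]) G i x)
  + \sum_(i < M) \int[mu]_(x in `[a, b]) G i x.
  rewrite -!big_split/=; under eq_bigr do rewrite subrKA subrK.
  by rewrite sumr_const card_ord mulr_natl.
rewrite (le_trans (ler_normD _ _))// (le_trans (lerD (ler_normD _ _) (lexx _)))//.
have -> : M%:R * (C ^+ 2 * (2 * (M%:R * s) + 2 * (b - a) * (M%:R * s / t) `^ alpha +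
     (b - a) * (M%:R `^ alpha / M%:R))) =
  M%:R * (C ^+ 2 * (2 * (M%:R * s))) +
  M%:R * (C ^+ 2 * (2 * (b - a) * (M%:R * s / t) `^ alpha)) +
  C ^+ 2 * ((b - a) * M%:R `^ alpha).
  by move: ((M%:R * s / t) `^ alpha) (M%:R `^ alpha) => X Z; field; rewrite gt_eqF.
rewrite lerD// lerD//.
  rewrite (le_trans (ler_norm_sum _ _ _))// (le_trans (ler_sum _ (fun i _ => t1 i)))//.
  by rewrite sumr_const card_ord [leRHS]mulr_natl.
rewrite (le_trans (ler_norm_sum _ _ _))// (le_trans (ler_sum _ (fun i _ => t2 i)))//.
by rewrite sumr_const card_ord [leRHS]mulr_natl.
Qed.

End DividedDifference.

(** * Geometric decay of correlations and the law of large numbers along geometric scales *)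

Section LawOfLargeNumbers.
Context (R : realType) (alpha : R) (f : R -> R) (C : R).
Notation mu := (@lebesgue_measure R).
Notation D := (divided_difference alpha f).

Lemma powR_exprn (x a : R) (n : nat) : 0 <= x -> (x ^+ n) `^ a = (x `^ a) ^+ n.
Proof.
by move=> x0; rewrite -powR_mulrn// powRAC powR_mulrn// powR_ge0.
Qed.

Lemma powR_lt1 (x a : R) : 0 < x -> x < 1 -> 0 < a -> x `^ a < 1.
Proof.
move=> x0 x1 a0; apply: (@lt_le_trans _ _ (1 `^ a)); last by rewrite powR1.
by apply: gt0_ltr_powR; rewrite ?nnegrE// ltW.
Qed.

Lemma powR_ge_self (x a : R) : 0 < x -> x <= 1 -> a <= 1 -> x <= x `^ a.
Proof. by move=> x0 x1 a1; apply: ger1_powR; rewrite ?x0. Qed.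

(** The number [M] of translations is taken of order [u^-d], the square root of the ratio of the two
    steps. The translations then cover a fraction of order [u^d] of the larger step, while averaging
    gains [M^(alpha - 1)], of order [u^(d (1 - alpha))]. Taking the ratio of scales as a square
    makes this square root a power of [u]. *)
Lemma divided_difference_correlation_decay (u a b : R) :
  (forall x y, `|f x - f y| <= C * `|x - y| `^ alpha) ->
  0 < alpha -> alpha < 1 -> 0 < u -> u < 1 -> a <= b ->
  exists K rho : R, [/\ 0 <= K, 0 <= rho, rho < 1 & forall j d,
    \int[mu]_(x in `[a, b]) (D x ((u ^+ 2) ^+ j) * D x ((u ^+ 2) ^+ (j + d)))
      <= K * rho ^+ d].
Proof.
move=> fH a0 a1 u0 u1 ab.
(* The three errors are bounded in [B1], [B2], [B3] by 2, 2 and 1 times [rho ^+ d]; with their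
   weights 2, [2 (b - a)] and [b - a] they give [4 + 5 (b - a)]. *)
exists (C ^+ 2 * (4 + 5 * (b - a))), (Num.max (u `^ alpha) (u `^ (1 - alpha))).
have ab0 : 0 <= b - a by lra.
split => [|||j d].
- by rewrite mulr_ge0 ?sqr_ge0// addr_ge0// mulr_ge0.
- by rewrite le_max powR_ge0.
- by rewrite gt_max !powR_lt1// subr_gt0.
set rho := Num.max _ _; set t := (u ^+ 2) ^+ j; set s := (u ^+ 2) ^+ (j + d).
set w := u ^+ d.
have u2 : 0 < u ^+ 2 by rewrite exprn_gt0.
have t0 : 0 < t by rewrite exprn_gt0.
have s0 : 0 < s by rewrite exprn_gt0.
have w0 : 0 < w by rewrite exprn_gt0.
have w1 : w <= 1 by rewrite exprn_ile1// ltW.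
have t1 : t <= 1 by rewrite exprn_ile1// ?exprn_ile1// ltW.
have sE : s = t * w ^+ 2 by rewrite /s exprD -/t /w -!exprM mulnC.
have wa : w `^ alpha <= rho ^+ d.
  rewrite /w powR_exprn ?(ltW u0)//; apply: lerXn2r; rewrite ?nnegrE ?powR_ge0//.
    by rewrite le_max powR_ge0.
  by rewrite le_max lexx.
have wb : w `^ (1 - alpha) <= rho ^+ d.
  rewrite /w powR_exprn ?(ltW u0)//; apply: lerXn2r; rewrite ?nnegrE ?powR_ge0//.
    by rewrite le_max powR_ge0.
  by rewrite le_max lexx orbT.
have wr : w <= rho ^+ d by apply: le_trans wa; apply: powR_ge_self => //; exact: ltW.
pose M := (Num.truncn (w^-1)).+1.
have wi1 : 1 <= w^-1 by rewrite invf_ge1.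
have wi0 : 0 <= w^-1 by rewrite invr_ge0 ltW.
have [M1 M2] : w^-1 <= M%:R /\ M%:R <= 2 * w^-1.
  have /andP[h1 h2] := truncn_itv wi0; split; first exact: ltW.
  by rewrite -(natr1 (Num.truncn _)); lra.
have MR : 0 < M%:R :> R by rewrite ltr0n.
have Mw1 : 1 <= M%:R * w by rewrite -ler_pdivrMr// div1r.
have Mw2 : M%:R * w <= 2 by rewrite -ler_pdivlMr.
have B1 : M%:R * s <= 2 * rho ^+ d.
  have : M%:R * s <= 2 * w.
    have -> : M%:R * s = (M%:R * w) * (t * w) by rewrite sE; ring.
    apply: ler_pM => //; rewrite ?mulr_ge0 ?(ltW w0) ?(ltW MR) ?(ltW t0)//.
    by rewrite ler_piMl// ltW.
  by move=> h; rewrite (le_trans h)// ler_wpM2l.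
have B2 : (M%:R * s / t) `^ alpha <= 2 * rho ^+ d.
  have -> : M%:R * s / t = (M%:R * w) * w by rewrite sE; field; rewrite gt_eqF.
  rewrite powRM ?mulr_ge0 ?(ltW w0) ?(ltW MR)//.
  apply: ler_pM; rewrite ?powR_ge0//.
  rewrite (le_trans _ Mw2)// -[leRHS]powRr1; last by rewrite (le_trans _ Mw1).
  by apply: ler_powR => //; exact: ltW.
have B3 : M%:R `^ alpha / M%:R <= rho ^+ d.
  apply: le_trans wb; rewrite ler_pdivrMr//.
  have wan : 0 < w `^ alpha by rewrite powR_gt0.
  rewrite -(ler_pM2r wan) -powRM ?(ltW w0) ?(ltW MR)//.
  have -> : w `^ (1 - alpha) * M%:R * w `^ alpha = M%:R * w.
    rewrite mulrAC -powRD ?subrK ?powRr1 ?(ltW w0) 1?mulrC//.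
    by rewrite (gt_eqF w0) implybT.
  rewrite -[leRHS]powRr1; last by rewrite (le_trans _ Mw1).
  by apply: ler_powR => //; exact: ltW.
rewrite (le_trans (ler_norm _))//.
rewrite (le_trans (divided_difference_correlation fH a0 s0 t0 ab (ltn0Sn _ : (0 < M)%N)))//.
rewrite -[leRHS]mulrA ler_wpM2l ?sqr_ge0//.
have h2 := ler_wpM2l ab0 B2; have h3 := ler_wpM2l ab0 B3.
lra.
Qed.

Lemma divided_difference_lln (u : R) :
  (forall x y, `|f x - f y| <= C * `|x - y| `^ alpha) ->
  0 < alpha -> alpha < 1 -> 0 < u -> u < 1 ->
  {ae mu, forall x, forall e, 0 < e -> exists N, forall n, (N <= n)%N ->
    `|\sum_(k < n) D x ((u ^+ 2) ^+ k)| <= e * n%:R}.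
Proof.
move=> fH a0 a1 u0 u1.
(* The strong law is applied on domains of finite measure; countably many intervals exhaust the
   line. *)
suff : {ae mu, forall x, forall m : nat, `[- m%:R, m%:R]%classic x ->
    forall e, 0 < e -> exists N, forall n, (N <= n)%N ->
    `|\sum_(k < n) D x ((u ^+ 2) ^+ k)| <= e * n%:R}.
  apply: (@filterS _ _ (ae_filter_ringOfSetsType mu)) => x /(_ (Num.truncn `|x|).+1); apply => /=.
  by rewrite in_itv/= -ler_norml ltW// truncnS_gt.
apply: ae_foralln => m.
have ab : - m%:R <= m%:R :> R by rewrite (@le_trans _ _ 0)// oppr_le0.
have [K [rho [K0 r0 r1 H]]] := divided_difference_correlation_decay fH a0 a1 u0 u1 ab.
have q0 k : 0 < (u ^+ 2) ^+ k by rewrite !exprn_gt0.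
apply: (@strong_law_of_decaying_correlations _ _ R mu _ _ _
  (fun k x => D x ((u ^+ 2) ^+ k)) C _ _ K rho) => //.
- exact: lebesgue_measure_itv_lty.
- move=> k; apply: measurable_funTS; apply: continuous_measurable_fun.
  exact: divided_difference_continuous fH a0 _.
- by move=> k x _; exact: divided_difference_bound fH _ _ (q0 k).
Qed.

End LawOfLargeNumbers.

(** * Densities of sets of scales *)

Section LogarithmicMeasure.
Context (R : realType).
Notation mu := (@lebesgue_measure R).
Implicit Types (E A B : set R) (P : pred nat).

Lemma measurable_inv_itv0y : measurable_fun (`]0, +oo[%classic : set R) (fun h : R => (h^-1)%:E).
Proof.
apply/measurable_EFinP; apply: open_continuous_measurable_fun.
  exact: interval_open.
by move=> x; rewrite inE/= in_itv/= andbT => x0; apply: inv_continuous; rewrite gt_eqF.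
Qed.

Lemma sigma_setU A B : measurable A -> measurable B ->
  A `<=` `]0, +oo[ -> B `<=` `]0, +oo[ -> [disjoint A & B] ->
  sigma (A `|` B) = (sigma A + sigma B)%E.
Proof.
move=> mA mB A0 B0 AB; rewrite /sigma ge0_integral_setU//.
- apply: measurable_funS measurable_inv_itv0y => //.
  by move=> x [/A0|/B0].
- by move=> x [/A0|/B0]; rewrite /= in_itv/= andbT lee_fin invr_ge0; exact: ltW.
Qed.

Lemma sigma_ge0 E : E `<=` `]0, +oo[ -> (0 <= sigma E)%E.
Proof.
move=> E0; apply: integral_ge0 => x /E0.
by rewrite /= in_itv/= andbT lee_fin invr_ge0; exact: ltW.
Qed.

Lemma le_sigma A B : measurable A -> measurable B ->
  B `<=` `]0, +oo[ -> A `<=` B -> (sigma A <= sigma B)%E.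
Proof.
move=> mA mB B0 AB; apply: ge0_subset_integral => //.
- exact: measurable_funS measurable_inv_itv0y.
- by move=> x /B0; rewrite /= in_itv/= andbT lee_fin invr_ge0; exact: ltW.
Qed.

Lemma sub_itv0y (a b : R) (b0 b1 : bool) : 0 < a ->
  [set` Interval (BSide b0 a) (BSide b1 b)] `<=` `]0, +oo[.
Proof.
move=> a0; apply: subset_itv; last by [].
by case: b0; rewrite bnd_simp// ltW.
Qed.

Lemma sigma_itv_le (a b : R) : 0 < a -> a <= b ->
  (sigma `[a, b[ <= ((b - a) / a)%:E)%E.
Proof.
move=> a0 ab; rewrite mulrC EFinM -(fine_lebesgue_measure_itv true true ab).
rewrite fineK; last by rewrite ge0_fin_numE// lebesgue_measure_itv_lty.
rewrite -integral_cst//; apply: ge0_le_integral => //.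
- by move=> x; rewrite /= in_itv/= => /andP[ax _]; rewrite lee_fin invr_ge0 (le_trans (ltW a0)).
- by apply: measurable_funS measurable_inv_itv0y => //; exact: sub_itv0y.
- move=> x; rewrite /= in_itv/= => /andP[ax _]; rewrite lee_fin.
  by rewrite lef_pV2// posrE// (lt_le_trans a0).
Qed.

Lemma sigma_itv_ge (a b : R) : 0 < a -> a <= b ->
  (((b - a) / b)%:E <= sigma `[a, b[)%E.
Proof.
move=> a0 ab; have b0 : 0 < b by apply: lt_le_trans ab.
rewrite mulrC EFinM -(fine_lebesgue_measure_itv true true ab).
rewrite fineK; last by rewrite ge0_fin_numE// lebesgue_measure_itv_lty.
rewrite -integral_cst//; apply: ge0_le_integral => //.
- by move=> x _; rewrite lee_fin invr_ge0 ltW.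
- by apply: measurable_funS measurable_inv_itv0y => //; exact: sub_itv0y.
- move=> x; rewrite /= in_itv/= => /andP[ax xb]; rewrite lee_fin.
  by rewrite lef_pV2 ?posrE// ?(lt_le_trans a0)// ltW.
Qed.

Lemma sigma_itv_split E (a b : R) : measurable E -> 0 < a -> a <= b -> b <= 1 ->
  sigma (`[a, 1%R] `&` E) = (sigma (`[b, 1%R] `&` E) + sigma (`[a, b[ `&` E))%E.
Proof.
move=> mE a0 ab b1; have b0 : 0 < b by apply: lt_le_trans ab.
rewrite -sigma_setU.
- rewrite -setIUl setUC -itv_bndbnd_setU// bnd_simp//.
- exact: measurableI.
- exact: measurableI.
- by move=> x [+ _]; exact: sub_itv0y.
- by move=> x [+ _]; exact: sub_itv0y.
- apply/disj_setPS => x [[+ _] [+ _]]; rewrite /= !in_itv/= => /andP[bx _] /andP[_].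
  by rewrite ltNge bx.
Qed.

(** [[q^n, 1[] is cut into the blocks [[q^(k+1), q^k[], each of [sigma]-measure at most
    [(1 - q) / q]. A block where [P k] fails misses [E], and the leftover point 1 is null. *)
Lemma sigma_count_le E P (q : R) (n : nat) : measurable E -> 0 < q -> q < 1 ->
  (forall k t, E t -> q ^+ k.+1 <= t -> t <= q ^+ k -> P k) ->
  (sigma (`[(q ^+ n)%R, 1%R] `&` E) <= ((\sum_(k < n) (P k)%:R) * ((1 - q) / q))%:E)%E.
Proof.
move=> mE q0 q1 EP; elim: n => [|n IH].
  rewrite expr0 big_ord0 mul0r set_itv1.
  have -> : sigma ([set 1] `&` E) = 0; last by [].
  apply/eqP; rewrite eq_le sigma_ge0 ?andbT; last first.
    by move=> x [-> _]; rewrite /= in_itv/= ltr01.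
  rewrite -(@integral_set1 R (fun h => (h^-1)%:E) 1); apply: le_sigma => //.
  - exact: measurableI.
  - by move=> x ->; rewrite /= in_itv/= ltr01.
have qn k : 0 < q ^+ k by exact: exprn_gt0.
have qS : q ^+ n.+1 <= q ^+ n by rewrite exprSr ler_piMr// ltW.
rewrite (sigma_itv_split mE (qn _) qS); last by rewrite exprn_ile1// ltW.
rewrite big_ord_recr/= mulrDl EFinD leeD//.
have [Pn|nPn] := boolP (P n).
  rewrite mul1r; have -> : (1 - q) / q = (q ^+ n - q ^+ n.+1) / q ^+ n.+1.
    by rewrite exprS; field; rewrite !gt_eqF.
  apply: le_trans (sigma_itv_le (qn n.+1) qS).
  apply: le_sigma => //; first exact: measurableI.
  exact: sub_itv0y.
rewrite mul0r (_ : `[_, _[ `&` E = set0) /sigma ?integral_set0//.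
apply/seteqP; split => // x [+ Ex]; rewrite /= in_itv/= => /andP[x1 x2].
by move: nPn; rewrite (EP n x Ex x1 (ltW x2)).
Qed.

(** Since [q <= r], the pieces [[r q^k, q^k[] lie in distinct blocks, so their measures, each at
    least [1 - r], add up. *)
Lemma sigma_count_ge E P (q r : R) (n : nat) : measurable E ->
  0 < q -> q <= r -> r < 1 ->
  (forall k t, P k -> r * q ^+ k <= t -> t < q ^+ k -> E t) ->
  (((\sum_(k < n) (P k)%:R) * (1 - r))%:E <= sigma (`[(q ^+ n)%R, 1%R] `&` E))%E.
Proof.
move=> mE q0 qr r1 PE; have qn k : 0 < q ^+ k by exact: exprn_gt0.
have r0 : 0 < r by apply: lt_le_trans qr.
have q1 : q < 1 by apply: le_lt_trans r1.
elim: n => [|n IH].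
  rewrite expr0 big_ord0 mul0r; apply: sigma_ge0 => x [+ _].
  exact: sub_itv0y.
have qS : q ^+ n.+1 <= q ^+ n by rewrite exprSr ler_piMr// ltW.
rewrite (sigma_itv_split mE (qn _) qS); last by rewrite exprn_ile1// ltW.
rewrite big_ord_recr/= mulrDl EFinD leeD//.
have [Pn|nPn] := boolP (P n); last first.
  by rewrite mul0r; apply: sigma_ge0 => x [+ _]; exact: sub_itv0y.
rewrite mul1r; have -> : 1 - r = (q ^+ n - r * q ^+ n) / q ^+ n.
  by field; rewrite gt_eqF.
have rq : 0 < r * q ^+ n by rewrite mulr_gt0.
apply: le_trans (sigma_itv_ge rq _) _; first by rewrite ler_piMl// ltW.
apply: le_sigma => //.
- exact: measurableI.
- by move=> x [+ _]; exact: sub_itv0y.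
- move=> x; rewrite /= in_itv/= => /andP[x1 x2]; split; last exact: PE Pn x1 x2.
  by rewrite /= in_itv/= x2 andbT (le_trans _ x1)// exprS ler_wpM2r// ltW.
Qed.

Lemma upper_log_density_gt0P E : (0 < upper_log_density E)%E <->
  exists2 eta : R, 0 < eta & forall h0, 0 < h0 -> exists h, [/\ 0 < h, h < h0 &
    (eta%:E <= sigma (`[h, 1%R] `&` E) / (ln h^-1)%:E)%E].
Proof.
rewrite /upper_log_density limf_esupE; split => [L0|[eta eta0 H]]; last first.
  apply: (@lt_le_trans _ _ eta%:E); first by rewrite lte_fin.
  apply: le_ereal_inf_tmp => _ [V VF <-].
  have [e /= e0 eV] : exists2 e : R, 0 < e & forall h, 0 < h -> h < e -> V h.
    move: VF => /nbhs_ballP[e /= e0 eV]; exists e => // h h0 he.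
    by apply: eV => //; rewrite /ball/= sub0r normrN gtr0_norm.
  have [h [h0 he hE]] := H _ e0.
  by apply: le_trans hE _; apply: ereal_sup_ubound; exists h => //; exact: eV.
(* A real strictly below the infimum is exceeded by the quotient at some point of every
   neighborhood; the infimum may be infinite, and then 1 serves. *)
have [eta eta0 etaL] : exists2 eta : R, 0 < eta & (eta%:E < ereal_inf
    [set ereal_sup ((fun h : R => sigma (`[h, 1%R] `&` E) / (ln h^-1)%:E)%E @` V)
      | V in 0^'+])%E.
  move: L0; case: (ereal_inf _) => [r r0| _|//].
    by exists (r / 2); [rewrite divr_gt0|rewrite lte_fin gtr_pMr// invf_lt1// ltr1n].
  by exists 1 => //; exact: ltry.
exists eta => // h0 h0_gt0.
have VF : (0:R)^'+ [set h : R | 0 < h /\ h < h0].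
  by near=> h; split; near: h; [exact: nbhs_right_gt|exact: nbhs_right_lt].
have /ereal_sup_gt[_ [h /= [h1 h2] <-] hE] := lt_le_trans etaL
  (ereal_inf_lbound (ex_intro2 _ _ _ VF erefl)).
by exists h; split => //; exact: ltW.
Unshelve. all: by end_near. Qed.

(** * Transfer between densities of scales and densities of exponents *)

Definition positive_upper_density P := exists2 eta : R, 0 < eta &
  forall N, exists2 n, (N <= n)%N & eta * n%:R <= \sum_(k < n) (P k)%:R.

Lemma positive_upper_density_of_log E P (q : R) : measurable E ->
  0 < q -> q < 1 ->
  (forall k t, E t -> q ^+ k.+1 <= t -> t <= q ^+ k -> P k) ->
  (0 < upper_log_density E)%E -> positive_upper_density P.
Proof.
move=> mE q0 q1 EP /upper_log_density_gt0P[eta eta0 H].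
have qn k : 0 < q ^+ k by exact: exprn_gt0.
have lq : 0 < ln q^-1 by rewrite ln_gt0// invf_gt1.
have c0 : 0 < (1 - q) / q by rewrite divr_gt0// subr_gt0.
(* The 2 pays for rounding [h] down to a power of [q]: with [q^n <= h < q^(n-1)] and [n >= 2],
   [ln h^-1] is at least [(n - 1) ln q^-1], hence at least half of [n ln q^-1]. *)
exists (eta * ln q^-1 / (2 * ((1 - q) / q))) => [|N].
  by apply: divr_gt0; apply: mulr_gt0.
have [h [h0 hq hE]] := H _ (qn N.+1).
have h1 : h < 1 by rewrite (lt_le_trans hq)// exprn_ile1// ltW.
have ex : exists n, q ^+ n <= h.
  have /cvgrPdist_lt/(_ _ h0)[n _ /(_ n (leqnn n))] : q ^+ n @[n --> \oo] --> 0.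
    by apply: cvg_expr; rewrite gtr0_norm.
  by rewrite sub0r normrN gtr0_norm// => /ltW; exists n.
case: (ex_minnP ex) => n nh nmin.
have Nn : (N.+1 < n)%N.
  rewrite ltnNge; apply/negP => nN.
  have : q ^+ N.+1 <= q ^+ n by rewrite ler_wiXn2l// ltW.
  by move=> /le_trans/(_ nh); rewrite leNgt hq.
have hn : h < q ^+ n.-1.
  rewrite ltNge; apply/negP => /nmin; case: n Nn {nh nmin} => // n _.
  by rewrite /= ltnn.
exists n; first by rewrite ltnW// ltnW.
have ln_h : ln h^-1 >= n%:R / 2 * ln q^-1.
  have -> : n%:R / 2 * ln q^-1 = ln q^-1 * (n%:R / 2) by rewrite mulrC.
  have h3 : ln q^-1 * n.-1%:R <= ln h^-1.
    rewrite mulr_natr -lnXn ?invr_gt0// ler_ln ?posrE ?exprn_gt0 ?invr_gt0//.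
    by rewrite exprVn lef_pV2 ?posrE// ltW.
  rewrite (le_trans _ h3)// ler_wpM2l// ?(ltW lq)// ler_pdivrMr//.
  by rewrite -natrM ler_nat; lia.
have lh : 0 < ln h^-1 by rewrite ln_gt0// invf_gt1.
have hS : (sigma (`[h, 1%R] `&` E) <= ((\sum_(k < n) (P k)%:R) * ((1 - q) / q))%:E)%E.
  apply: le_trans (sigma_count_le n mE q0 q1 EP); apply: le_sigma.
  - exact: measurableI.
  - exact: measurableI.
  - by move=> x [+ _]; exact: sub_itv0y.
  - apply: setSI; apply: subset_itv => //.
have {}hE : eta * ln h^-1 <= (\sum_(k < n) (P k)%:R) * ((1 - q) / q).
  rewrite -lee_fin; apply: le_trans hS.
  by move: hE; rewrite inver gt_eqF// lee_pdivlMr// -EFinM.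
rewrite -(ler_pM2r c0) (le_trans _ hE)//.
have -> : eta * ln q^-1 / (2 * ((1 - q) / q)) * n%:R * ((1 - q) / q) =
    eta * (n%:R / 2 * ln q^-1).
  by move: (ln _) ((1 - q) / q) c0 => l c c0; field; rewrite gt_eqF.
by rewrite ler_wpM2l// ltW.
Qed.

Lemma upper_log_density_of_positive E P (q r : R) : measurable E ->
  0 < q -> q <= r -> r < 1 ->
  (forall k t, P k -> r * q ^+ k <= t -> t < q ^+ k -> E t) ->
  positive_upper_density P -> (0 < upper_log_density E)%E.
Proof.
move=> mE q0 qr r1 PE [eta eta0 H]; apply/upper_log_density_gt0P.
have q1 : q < 1 by apply: le_lt_trans r1.
have lq : 0 < ln q^-1 by rewrite ln_gt0// invf_gt1.
exists (eta * (1 - r) / ln q^-1) => [|h0 h0_gt0].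
  by rewrite divr_gt0 ?mulr_gt0 ?subr_gt0.
have [N _ hN] : \forall n \near \oo, q ^+ n < h0.
  have /cvgrPdist_lt/(_ _ h0_gt0) : q ^+ n @[n --> \oo] --> 0.
    by apply: cvg_expr; rewrite gtr0_norm.
  by apply: filterS => n; rewrite sub0r normrN gtr0_norm// exprn_gt0.
have [n Nn nP] := H N.+1.
exists (q ^+ n); split; [exact: exprn_gt0|by apply: hN; exact: ltnW|].
have n0 : 0 < n%:R :> R by rewrite ltr0n (leq_trans _ Nn).
rewrite -exprVn lnXn ?invr_gt0// -mulr_natr.
have lqn : 0 < ln q^-1 * n%:R by rewrite mulr_gt0.
rewrite inver gt_eqF// lee_pdivlMr// -EFinM.
apply: le_trans (sigma_count_ge n mE q0 qr r1 PE); rewrite lee_fin.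
have -> : eta * (1 - r) / ln q^-1 * (ln q^-1 * n%:R) = eta * n%:R * (1 - r).
  by field; rewrite gt_eqF.
by rewrite ler_wpM2r// subr_ge0 ltW.
Qed.

(** Each [a k] is at least [delta] times the indicator of [delta < a k], minus [c], minus [C] times
    the indicator of [a k < - c]. Summing, the positive part can be offset only by many terms below
    [- c]. *)
Lemma positive_upper_density_lt_of_gt (a : nat -> R) (C delta : R) :
  0 < delta -> 0 < C -> (forall k, `|a k| <= C) ->
  (forall e, 0 < e -> exists N, forall n, (N <= n)%N ->
     `|\sum_(k < n) a k| <= e * n%:R) ->
  positive_upper_density (fun k => delta < a k) ->
  exists2 c : R, 0 < c & positive_upper_density (fun k => a k < - c).
Proof.
move=> delta0 C0 aC lln [eta eta0 H].
(* Of the gain [4 c] per index, one [c] is lost to terms that are only [>= - c] and one to the mean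
   bound; [2 c] remains. *)
have [c c0 cE] : exists2 c, 0 < c & delta * eta = 4 * c.
  by exists (delta * eta / 4); [rewrite divr_gt0// mulr_gt0|field].
exists c => //; exists (2 * c / C) => [|N]; first by rewrite divr_gt0// mulr_gt0.
have [N' HN'] := lln c c0.
have [n nN nH] := H (maxn N N').
exists n; first by rewrite (leq_trans (leq_maxl _ _) nN).
have {HN'} := HN' n (leq_trans (leq_maxr _ _) nN); rewrite ler_norml => /andP[_ Sn].
have : \sum_(k < n) (delta * (delta < a k)%R%:R - c - C * (a k < - c)%R%:R) <=
    \sum_(k < n) a k.
  apply: ler_sum => k _; have := aC k; rewrite ler_norml => /andP[a1 a2].
  have [h1|h1] := ltP delta (a k); have [h2|h2] := ltP (a k) (- c);
    rewrite /= ?mulr1 ?mulr0; lra.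
rewrite big_split big_split/= -mulr_sumr !sumrN -mulr_sumr sumr_const card_ord.
rewrite -[c *+ n]mulr_natr => h.
have h4 := ler_wpM2l (ltW delta0) nH.
rewrite mulrAC ler_pdivrMr//; rewrite mulrA cE in h4.
by rewrite [leRHS]mulrC; lra.
Qed.

End LogarithmicMeasure.

(** * From discrete scales to all scales *)

Section LogarithmicScale.
Context (R : realType) (alpha : R) (f : R -> R) (C : R).
Notation D := (divided_difference alpha f).

Lemma measurable_divided_difference (x : R) :
  continuous f -> measurable_fun setT (D x).
Proof.
move=> cf.
have -> : D x = (fun t => (f (x + t) - f x) * `|t| `^ (- alpha)).
  by apply/funext => t; rewrite powRN.
apply: measurable_funM.
  apply: measurable_funB => //; apply: continuous_measurable_fun.
  have -> : (fun t => f (x + t)) = (fun t => f (t + x)).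
    by apply/funext => t; rewrite addrC.
  exact: continuous_translate.
apply: (@measurableT_comp _ _ _ _ _ _ (fun t => t `^ (- alpha))).
  exact: measurable_powR.
exact: normr_measurable.
Qed.

Lemma divided_difference_log_scale (e : R) :
  (forall x y, `|f x - f y| <= C * `|x - y| `^ alpha) ->
  0 < alpha -> alpha < 1 -> 0 < C -> 0 < e ->
  exists2 r, 0 < r < 1 &
    forall x s t, 0 < s -> r * s <= t -> t <= s -> `|D x t - D x s| <= e.
Proof.
move=> fH a0 a1 C0 e0.
(* The second argument gives [2 C v^alpha <= e]; the cap at 1 gives [v <= v^alpha]. *)
pose v := Num.min 1 ((e / (2 * C)) `^ alpha^-1).
have v0 : 0 < v by rewrite lt_min ltr01 powR_gt0// divr_gt0// mulr_gt0.
have v1 : v <= 1 by rewrite ge_min lexx.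
have va : v `^ alpha <= e / (2 * C).
  have <- : ((e / (2 * C)) `^ alpha^-1) `^ alpha = e / (2 * C).
    by rewrite -powRrM mulVf ?gt_eqF// powRr1// divr_ge0 ?mulr_ge0 ?ltW.
  apply: ge0_ler_powR; rewrite ?nnegrE ?powR_ge0 ?(ltW a0) ?(ltW v0)//.
  by rewrite ge_min lexx orbT.
have v10 : 0 < 1 + v by lra.
exists (1 + v)^-1; first by rewrite invr_gt0 v10 invf_lt1//; lra.
move=> x s t s0 rst ts.
have t0 : 0 < t by apply: lt_le_trans rst; rewrite mulr_gt0// invr_gt0.
have st : s <= (1 + v) * t by rewrite -ler_pdivrMl.
(* The difference is split into the change of endpoint ([T1]) and the change of normalisation
   ([T2]); the latter is controlled by [(s / t)^alpha - 1 <= (1 + v)^alpha - 1 <= v]. *)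
have T1 : `|(f (x + t) - f (x + s)) / t `^ alpha| <= C * v `^ alpha.
  rewrite normrM normfV (ger0_norm (powR_ge0 t _)) ler_pdivrMr ?powR_gt0//.
  rewrite (le_trans (fH _ _))// -mulrA ler_pM2l// -powRM ?(ltW v0) ?(ltW t0)//.
  have -> : x + t - (x + s) = - (s - t) by ring.
  rewrite normrN ger0_norm ?subr_ge0//.
  by apply: ge0_ler_powR; rewrite ?nnegrE ?subr_ge0 ?mulr_ge0 ?(ltW a0) ?(ltW v0) ?(ltW t0)//; lra.
have T2 : `|(f (x + s) - f x) * ((t `^ alpha)^-1 - (s `^ alpha)^-1)| <= C * v `^ alpha.
  have sa : 0 < s `^ alpha by rewrite powR_gt0.
  have ta : 0 < t `^ alpha by rewrite powR_gt0.
  have tsa : t `^ alpha <= s `^ alpha.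
    by apply: ge0_ler_powR; rewrite ?nnegrE ?(ltW a0) ?(ltW s0) ?(ltW t0).
  rewrite normrM [X in _ * X]ger0_norm; last first.
    by rewrite subr_ge0 lef_pV2.
  apply: (@le_trans _ _ (C * s `^ alpha * ((t `^ alpha)^-1 - (s `^ alpha)^-1))).
    apply: ler_wpM2r; first by rewrite subr_ge0 lef_pV2.
    by rewrite (le_trans (fH _ _))// addrC addKr gtr0_norm.
  rewrite -mulrA ler_pM2l// mulrBr divff ?gt_eqF// -powR_div ?(ltW s0) ?(ltW t0)//.
  apply: (@le_trans _ _ v); last by apply: powR_ge_self => //; exact: ltW.
  rewrite lerBlDl (@le_trans _ _ ((1 + v) `^ alpha))//.
    apply: ge0_ler_powR; rewrite ?nnegrE ?divr_ge0 ?(ltW a0) ?(ltW s0) ?(ltW t0) ?(ltW v10)//.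
    by rewrite ler_pdivrMr.
  rewrite -[leRHS]powRr1 ?(ltW v10)//; apply: ler_powR; last exact: ltW.
  by rewrite lerDl ltW.
have -> : D x t - D x s = (f (x + t) - f (x + s)) / t `^ alpha +
    (f (x + s) - f x) * ((t `^ alpha)^-1 - (s `^ alpha)^-1).
  by rewrite /divided_difference !gtr0_norm//; ring.
rewrite (le_trans (ler_normD _ _))// (le_trans (lerD T1 T2))//.
have h : 2 * C * v `^ alpha <= e.
  by rewrite mulrC -ler_pdivlMr// mulr_gt0.
lra.
Qed.

End LogarithmicScale.

(** Provides a countable family of ratios approaching 1, so that the exceptional null sets can be
    united. With [y] the harmonic term, [(1 - y)^2 >= 1 - 2 y]. *)
Lemma sqr_harmonic_ge (R : realType) (r : R) : r < 1 ->
  exists m : nat, r <= (1 - m.+2%:R^-1) ^+ 2.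
Proof.
move=> r1; have r0 : 0 < 1 - r by rewrite subr_gt0.
exists (Num.truncn (2 / (1 - r))).
set m := Num.truncn _.
have hm : 2 / (1 - r) < m.+2%:R.
  by rewrite (lt_trans (truncnS_gt _))// ltr_nat.
have m0 : 0 < m.+2%:R :> R by [].
have : m.+2%:R^-1 <= (1 - r) / 2.
  by rewrite -[leRHS]invf_div lef_pV2 ?posrE ?divr_gt0// ltW.
have := sqr_ge0 (m.+2%:R^-1 : R).
by move: (m.+2%:R^-1) => y y2 h; nra.
Qed.

(** * From geometric scales to the almost everywhere statement *)

Unset Implicit Arguments.

Theorem theorem1 (R : realType) (alpha : R) (f : R -> R)
    (alpha_gt0 : 0 < alpha) (alpha_lt1 : alpha < 1)
    (f_holder : holder_class alpha f) :
  {ae @lebesgue_measure R, forall x : R,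
    (exists2 delta : R, 0 < delta &
      (0 < upper_log_density
             [set t | divided_difference alpha f x t > delta]%R)%E) ->
    (exists2 c : R, 0 < c &
      (0 < upper_log_density
             [set t | divided_difference alpha f x t < - c]%R)%E)}.
Proof.
have [C C0 fH] := f_holder.
(* The ratio needed at [x] depends on [delta(x)], so the law of large numbers is first secured for
   all these ratios simultaneously. *)
pose u (m : nat) : R := 1 - m.+2%:R^-1.
have u0 m : 0 < u m by rewrite subr_gt0 invf_lt1// ltr1n.
have u1 m : u m < 1 by rewrite ltrBlDr ltrDl invr_gt0.
have cf := holder_continuous fH alpha_gt0.
have mD x : measurable_fun setT (divided_difference alpha f x).
  exact: measurable_divided_difference.
apply: (@filterS _ _ (ae_filter_ringOfSetsType (@lebesgue_measure R)) _ _ _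
  (ae_foralln (fun m => divided_difference_lln fH alpha_gt0 alpha_lt1 (u0 m) (u1 m)))).
move=> x lln [delta delta0 delta_density].
have d2 : 0 < delta / 2 by rewrite divr_gt0.
have [r /andP[r0 r1] rP] := divided_difference_log_scale fH alpha_gt0 alpha_lt1 C0 d2.
have [m rm] := sqr_harmonic_ge r1.
set q := u m ^+ 2.
have q0 : 0 < q by rewrite exprn_gt0.
have q1 : q < 1 by rewrite exprn_ilt1// ltW.
have qn k : 0 < q ^+ k by rewrite exprn_gt0.
(* [q >= r] makes the oscillation over a block at most [delta / 2], so one scale above [delta] in
   the block puts its top scale [q^k] above [delta / 2]. *)
have up_freq : @positive_upper_density R
    (fun k => delta / 2 < divided_difference alpha f x (q ^+ k)).
  apply: (positive_upper_density_of_log _ q0 q1 _ delta_density) => [|k t /= Dt kt tk].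
    rewrite -[X in measurable X]setTI.
    rewrite (_ : [set t | _] = divided_difference alpha f x @^-1` `]delta, +oo[).
      exact: mD.
    by apply/seteqP; split => t /=; rewrite in_itv/= andbT.
  have := rP x _ t (qn k) _ tk; rewrite ler_norml => /(_ _)/andP[].
    by rewrite (le_trans _ kt)// exprS ler_wpM2r// ltW.
  by move=> _; lra.
have [c c0 c_freq] := positive_upper_density_lt_of_gt d2 C0
  (fun k => divided_difference_bound fH x (qn k)) (lln m) up_freq.
exists (c / 2); first by rewrite divr_gt0.
have c2 : 0 < c / 2 by rewrite divr_gt0.
have [r' /andP[r'0 r'1] r'P] := divided_difference_log_scale fH alpha_gt0 alpha_lt1 C0 c2.
(* [c] was obtained after [q], so [q] cannot be refined to suit it. Only the top piece of each block
   is used: [r'] keeps the divided difference below [- (c / 2)] there, and [q] keeps the piece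
   inside its block. *)
apply: (@upper_log_density_of_positive R _ _ q (Num.max r' q) _ q0 _ _ _ c_freq).
- rewrite -[X in measurable X]setTI.
  rewrite (_ : [set t | _] = divided_difference alpha f x @^-1` `]-oo, (- (c / 2))[).
    exact: mD.
  by apply/seteqP; split => t /=; rewrite in_itv/=.
- by rewrite le_max lexx orbT.
- by rewrite gt_max r'1.
- move=> k t /= Dk kt tk.
  have := r'P x _ t (qn k) _ (ltW tk); rewrite ler_norml => /(_ _)/andP[].
    by rewrite (le_trans _ kt)// ler_wpM2r ?(ltW (qn k))// le_max lexx.
  by move=> _; lra.
Qed.
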